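(* Let $b$ be a geodesic ray (from $\mathfrak o$) in a proper CAT(0) space $X$ and suppose there is a constant $M$ such that every $(32,0)$--quasi-geodesic segment with both end points on $b$ lies in $\mathcal N_\kappa(b,M)$. Then $b$ is $\kappa$--contracting with contracting constant $c_b=82000\,M$.
   Context: $\|x\|=d_X(\mathfrak o,x)$; $\kappa:[0,\infty)\to[1,\infty)$ is monotone increasing, concave and sublinear, $\kappa(x):=\kappa(\|x\|)$. $\mathcal N_\kappa(Z,n)=\{x: d_X(x,Z)\le n\kappa(x)\}$. A $(q,Q)$--quasi-geodesic is a continuous map from an interval with $\frac1q|s-t|-Q\le d(\beta(s),\beta(t))\le q|s-t|+Q$. A closed set $Z$ is $\kappa$--contracting with constant $c_Z$ if for all $x,y$ with $d_X(x,y)\le d_X(x,Z)$, $\operatorname{diam}(x_Z\cup y_Z)\le c_Z\kappa(x)$, where $x_Z$ is the set of nearest points of $Z$ to $x$. *)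

(* Defs.v *)
From Stdlib Require Import Reals Lra List ClassicalEpsilon.
Open Scope R_scope.

Definition is_metric {X : Type} (d : X -> X -> R) : Prop :=
  (forall x y, 0 <= d x y) /\
  (forall x y, d x y = 0 <-> x = y) /\
  (forall x y, d x y = d y x) /\
  (forall x y z, d x z <= d x y + d y z).

Definition is_open {X : Type} (d : X -> X -> R) (U : X -> Prop) : Prop :=
  forall x, U x -> exists e, 0 < e /\ forall y, d x y < e -> U y.

Definition is_compact {X : Type} (d : X -> X -> R) (K : X -> Prop) : Prop :=
  forall (I : Type) (U : I -> X -> Prop),
    (forall i, is_open d (U i)) ->
    (forall x, K x -> exists i, U i x) ->
    exists l : list I, forall x, K x -> exists i, In i l /\ U i x.

Definition is_proper {X : Type} (d : X -> X -> R) : Prop :=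
  forall (x : X) (r : R), is_compact d (fun y => d x y <= r).

Definition is_geodesic_segment {X : Type} (d : X -> X -> R) (g : R -> X) (x y : X) : Prop :=
  g 0 = x /\ g (d x y) = y /\
  forall s t, 0 <= s <= d x y -> 0 <= t <= d x y -> d (g s) (g t) = Rabs (s - t).

Definition is_geodesic_space {X : Type} (d : X -> X -> R) : Prop :=
  forall x y, exists g, is_geodesic_segment d g x y.

Definition e2dist (p q : R * R) : R :=
  sqrt ((fst p - fst q) ^ 2 + (snd p - snd q) ^ 2).

Definition e2along (a b : R * R) (L s : R) : R * R :=
  (fst a + (s / L) * (fst b - fst a), snd a + (s / L) * (snd b - snd a)).

(* CAT(0) inequality: for every geodesic triangle (given by two sides from a
   common vertex x; all vertex choices and all geodesics are quantified over,
   so all pairs of points on the boundary are covered) and every Euclidean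
   comparison triangle, distances are at most the comparison distances. *)
Definition is_CAT0 {X : Type} (d : X -> X -> R) : Prop :=
  is_geodesic_space d /\
  forall (x y z : X) (g1 g2 : R -> X) (a b c : R * R),
    is_geodesic_segment d g1 x y ->
    is_geodesic_segment d g2 x z ->
    e2dist a b = d x y -> e2dist a c = d x z -> e2dist b c = d y z ->
    forall s t, 0 <= s <= d x y -> 0 <= t <= d x z ->
      d (g1 s) (g2 t) <= e2dist (e2along a b (d x y) s) (e2along a c (d x z) t).

Definition is_geodesic_ray {X : Type} (d : X -> X -> R) (o : X) (b : R -> X) : Prop :=
  b 0 = o /\ forall s t, 0 <= s -> 0 <= t -> d (b s) (b t) = Rabs (s - t).

Definition ray_image {X : Type} (b : R -> X) : X -> Prop :=
  fun z => exists t, 0 <= t /\ z = b t.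

Definition is_inf (S : R -> Prop) (r : R) : Prop :=
  (forall s, S s -> r <= s) /\ (forall r', (forall s, S s -> r' <= s) -> r' <= r).

Definition dist_set {X : Type} (d : X -> X -> R) (x : X) (Z : X -> Prop) : R :=
  epsilon (inhabits 0) (fun r => is_inf (fun s => exists z, Z z /\ s = d x z) r).

Definition proj_set {X : Type} (d : X -> X -> R) (Z : X -> Prop) (x : X) : X -> Prop :=
  fun z => Z z /\ d x z = dist_set d x Z.

Definition is_sublinear_fn (kappa : R -> R) : Prop :=
  (forall t, 0 <= t -> 1 <= kappa t) /\
  (forall s t, 0 <= s <= t -> kappa s <= kappa t) /\
  (forall s t l, 0 <= s -> 0 <= t -> 0 <= l <= 1 ->
     l * kappa s + (1 - l) * kappa t <= kappa (l * s + (1 - l) * t)) /\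
  (forall e, 0 < e -> exists T, forall t, T <= t -> 0 < t -> kappa t / t < e).

Definition kap {X : Type} (d : X -> X -> R) (o : X) (kappa : R -> R) (x : X) : R :=
  kappa (d o x).

Definition kappa_nbhd {X : Type} (d : X -> X -> R) (o : X) (kappa : R -> R)
  (Z : X -> Prop) (n : R) : X -> Prop :=
  fun x => dist_set d x Z <= n * kap d o kappa x.

Definition continuous_on_interval {X : Type} (d : X -> X -> R) (beta : R -> X) (s0 t0 : R) : Prop :=
  forall u, s0 <= u <= t0 -> forall e, 0 < e -> exists del, 0 < del /\
    forall v, s0 <= v <= t0 -> Rabs (u - v) < del -> d (beta u) (beta v) < e.

Definition is_quasi_geodesic_segment {X : Type} (d : X -> X -> R) (q Q : R)
  (beta : R -> X) (s0 t0 : R) : Prop :=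
  s0 <= t0 /\ continuous_on_interval d beta s0 t0 /\
  forall s t, s0 <= s <= t0 -> s0 <= t <= t0 ->
    (1 / q) * Rabs (s - t) - Q <= d (beta s) (beta t) /\
    d (beta s) (beta t) <= q * Rabs (s - t) + Q.

Definition is_kappa_contracting {X : Type} (d : X -> X -> R) (o : X) (kappa : R -> R)
  (Z : X -> Prop) (c : R) : Prop :=
  forall x y, d x y <= dist_set d x Z ->
    forall p q, (proj_set d Z x p \/ proj_set d Z y p) ->
                (proj_set d Z x q \/ proj_set d Z y q) ->
      d p q <= c * kap d o kappa x.

(* Main.v *)
(** Let [p], [q] be the projections of [x], [y] to the ray [b], at heights
    [R = d x p >= d x y] and [k = d y q], and put [D = d p q].  If along a
    geodesic [g] leaving [b] orthogonally at [p] the distance to [q] grows at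
    average rate at most 4/5 up to height [H], then by convexity going up [g] to
    height [H/16] and then straight to [q] is a (32,0)-quasi-geodesic, so
    [H/16 <= M kappa].  Such a corner exists over [p] or over [q] at a height
    comparable to [D]: otherwise the quadrilateral inequality makes the distance
    between the geodesics [p x] and [q y] grow at rate almost [2 * 4/5], so by
    convexity [d x y] would exceed [R] (after lowering [x] to height at most
    [d p y]). *)
Require Import Defs.
From Stdlib Require Import Reals Lra Psatz ClassicalEpsilon.
Open Scope R_scope.

(** * Geodesics of given length and nearest points *)

Definition geodesic_on {X : Type} (d : X -> X -> R) (g : R -> X) (L : R) : Prop :=
  0 <= L /\
  forall s t, 0 <= s <= L -> 0 <= t <= L -> d (g s) (g t) = Rabs (s - t).

(** Phrased by inequalities because [dist_set] is an [epsilon] choice; [dist_set_nearest] and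
    [proj_set_nearest] connect the two. *)
Definition is_nearest {X : Type} (d : X -> X -> R) (Z : X -> Prop) (x p : X) : Prop :=
  Z p /\ forall w, Z w -> d x p <= d x w.

Lemma geodesic_on_dist {X : Type} (d : X -> X -> R) g L s t :
  geodesic_on d g L -> 0 <= s -> s <= t -> t <= L -> d (g s) (g t) = t - s.
Proof.
  intros [_ Hg] Hs Hst Ht. rewrite Hg by lra.
  rewrite Rabs_left1; lra.
Qed.

Lemma geodesic_on_sub {X : Type} (d : X -> X -> R) g L s t :
  geodesic_on d g L -> 0 <= s -> s <= t -> t <= L ->
  geodesic_on d (fun r => g (s + r)) (t - s).
Proof.
  intros [_ Hg] Hs Hst Ht. split; [lra|]. intros u v Hu Hv.
  rewrite Hg by lra. f_equal; lra.
Qed.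

Lemma geodesic_on_rev {X : Type} (d : X -> X -> R) g L :
  geodesic_on d g L -> geodesic_on d (fun r => g (L - r)) L.
Proof.
  intros [HL Hg]. split; [lra|]. intros u v Hu Hv.
  rewrite Hg by lra. rewrite <- Rabs_Ropp. f_equal; lra.
Qed.

Lemma geodesic_on_exists {X : Type} (d : X -> X -> R) x y :
  is_metric d -> is_CAT0 d ->
  exists g, g 0 = x /\ g (d x y) = y /\ geodesic_on d g (d x y).
Proof.
  intros [Hpos _] [Hgeo _]. destruct (Hgeo x y) as [g [H0 [H1 Hg]]].
  exists g. repeat split; auto.
Qed.

Lemma geodesic_on_segment {X : Type} (d : X -> X -> R) g L :
  geodesic_on d g L -> is_geodesic_segment d g (g 0) (g L) /\ d (g 0) (g L) = L.
Proof.
  intros Hg. assert (E : d (g 0) (g L) = L).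
  { rewrite (geodesic_on_dist d g L); auto; [lra|lra|apply Hg|lra]. }
  split; [|exact E]. destruct Hg as [HL Hg].
  unfold is_geodesic_segment. rewrite E. auto.
Qed.

(** * Stewart's inequality and convexity of the distance *)

(** The law of cosines fixes the first coordinate of the apex, and the triangle inequalities say
    that its modulus is at most [e]. The last two equations allow [stewart] to eliminate the
    coordinates. *)
Lemma comparison_triangle (L e f : R) :
  0 < L -> 0 <= e -> 0 <= f -> e <= L + f -> f <= L + e -> L <= e + f ->
  exists c : R * R,
    e2dist (0, 0) (L, 0) = L /\ e2dist (0, 0) c = e /\ e2dist (L, 0) c = f /\
    2 * L * fst c = L ^ 2 + e ^ 2 - f ^ 2 /\ fst c ^ 2 + snd c ^ 2 = e ^ 2.
Proof.
  intros HL He Hf H1 H2 H3.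
  set (c1 := (L ^ 2 + e ^ 2 - f ^ 2) / (2 * L)).
  assert (Ec1 : 2 * L * c1 = L ^ 2 + e ^ 2 - f ^ 2) by (unfold c1; field; lra).
  assert (Hc : 0 <= e ^ 2 - c1 ^ 2).
  { assert (A : 0 <= e - c1).
    { apply Rmult_le_reg_l with (2 * L); [lra|].
      rewrite Rmult_0_r.
      replace (2 * L * (e - c1)) with (f ^ 2 - (L - e) ^ 2) by nra. nra. }
    assert (B : 0 <= e + c1).
    { apply Rmult_le_reg_l with (2 * L); [lra|].
      rewrite Rmult_0_r.
      replace (2 * L * (e + c1)) with ((L + e) ^ 2 - f ^ 2) by nra. nra. }
    nra. }
  assert (Es : sqrt (e ^ 2 - c1 ^ 2) ^ 2 = e ^ 2 - c1 ^ 2) by (apply pow2_sqrt; exact Hc).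
  set (c2 := sqrt (e ^ 2 - c1 ^ 2)) in *. clearbody c1 c2.
  exists (c1, c2). unfold e2dist; cbn [fst snd].
  split; [|split; [|split; [|split]]].
  - replace ((0 - L) ^ 2 + (0 - 0) ^ 2) with (L ^ 2) by ring. apply sqrt_pow2; lra.
  - replace ((0 - c1) ^ 2 + (0 - c2) ^ 2) with (e ^ 2) by nra.
    apply sqrt_pow2; lra.
  - replace ((L - c1) ^ 2 + (0 - c2) ^ 2) with (f ^ 2) by nra.
    apply sqrt_pow2; lra.
  - exact Ec1.
  - lra.
Qed.

Lemma scaled_range (tau L : R) : 0 <= tau <= 1 -> 0 <= L -> 0 <= tau * L <= L.
Proof. nra. Qed.

(** In the plane this is Stewart's theorem, with equality; the CAT(0) inequality carries it over
    when the second comparison point is the vertex [z]. *)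
Lemma stewart {X : Type} (d : X -> X -> R) g L z tau :
  is_metric d -> is_CAT0 d -> geodesic_on d g L -> 0 <= tau <= 1 ->
  d (g (tau * L)) z ^ 2 <=
    (1 - tau) * d (g 0) z ^ 2 + tau * d (g L) z ^ 2 - tau * (1 - tau) * L ^ 2.
Proof.
  intros [Hpos [Hz [Hsym Htri]]] [Hgeo Hcat] Hg Ht.
  destruct (geodesic_on_segment d g L Hg) as [Hseg Ed].
  (* [e2along] divides by side lengths, so [L = 0] and [d (g 0) z = 0] are settled apart. *)
  destruct (proj1 Hg) as [HL|HL].
  2:{ subst L. rewrite Rmult_0_r. lra. }
  assert (Hs := scaled_range tau L Ht (Rlt_le _ _ HL)).
  destruct (Hpos (g 0) z) as [He|He].
  2:{ assert (E : g 0 = z) by (apply Hz; auto). rewrite <- E.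
      rewrite (Hsym (g (tau * L))), (Hsym (g L)), Ed.
      rewrite (proj2 (Hz (g 0) (g 0)) eq_refl).
      assert (HL0 := proj1 Hg). rewrite (geodesic_on_dist d g L) by (auto; lra). nra. }
  set (e := d (g 0) z) in *. set (f := d (g L) z) in *.
  assert (T1 := Htri (g 0) (g L) z). assert (T2 := Htri (g L) (g 0) z).
  assert (T3 := Htri (g 0) z (g L)). assert (Hf := Hpos (g L) z).
  rewrite (Hsym (g L) (g 0)) in T2. rewrite (Hsym z (g L)) in T3.
  rewrite Ed in T1, T2, T3. fold e f in T1, T2, T3, Hf.
  destruct (comparison_triangle L e f) as [c [E1 [E2 [E3 [E4 E5]]]]]; try lra.
  destruct (Hgeo (g 0) z) as [g2 Hg2].
  assert (Hin := Hcat (g 0) (g L) z g g2 (0, 0) (L, 0) c Hseg Hg2).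
  fold e f in Hin. rewrite Ed in Hin.
  specialize (Hin E1 E2 E3 (tau * L) e Hs ltac:(lra)).
  destruct Hg2 as [_ [Hg2 _]]. fold e in Hg2. rewrite Hg2 in Hin.
  unfold e2along, e2dist in Hin; cbn [fst snd] in Hin.
  replace (0 + tau * L / L * (L - 0) - (0 + e / e * (fst c - 0)))
    with (tau * L - fst c) in Hin by (field; split; lra).
  replace (0 + tau * L / L * (0 - 0) - (0 + e / e * (snd c - 0)))
    with (- snd c) in Hin by (field; split; lra).
  assert (Hp := Hpos (g (tau * L)) z).
  assert (Hsq : d (g (tau * L)) z ^ 2 <= (tau * L - fst c) ^ 2 + (- snd c) ^ 2).
  { rewrite <- (pow2_sqrt ((tau * L - fst c) ^ 2 + (- snd c) ^ 2))
      by (apply Rplus_le_le_0_compat; apply pow2_ge_0).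
    apply pow_incr; split; assumption. }
  replace ((tau * L - fst c) ^ 2 + (- snd c) ^ 2)
    with (tau ^ 2 * L ^ 2 - tau * (2 * L * fst c) + (fst c ^ 2 + snd c ^ 2)) in Hsq by ring.
  rewrite E4, E5 in Hsq. lra.
Qed.

Lemma Rle_of_sq (x y : R) : 0 <= y -> x ^ 2 <= y ^ 2 -> x <= y.
Proof. intros; nra. Qed.

(** With [e], [f] the distances from the ends to [z], the squared right side is the bound of
    [stewart] with [(e - f)^2] in place of [L^2], and [Rabs (e - f) <= L]. *)
Lemma dist_geodesic_convex {X : Type} (d : X -> X -> R) g L z tau :
  is_metric d -> is_CAT0 d -> geodesic_on d g L -> 0 <= tau <= 1 ->
  d (g (tau * L)) z <= (1 - tau) * d (g 0) z + tau * d (g L) z.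
Proof.
  intros Hm Hc Hg Ht. assert (HS := stewart d g L z tau Hm Hc Hg Ht).
  destruct (geodesic_on_segment d g L Hg) as [_ Ed].
  destruct Hm as [Hpos [_ [Hsym Htri]]].
  assert (P1 := Hpos (g 0) z). assert (P2 := Hpos (g L) z).
  assert (T1 := Htri (g 0) (g L) z). assert (T2 := Htri (g L) (g 0) z).
  rewrite (Hsym (g L) (g 0)) in T2. rewrite Ed in T1, T2.
  apply Rle_of_sq; [nra|]. eapply Rle_trans; [exact HS|].
  assert (Hd : (d (g 0) z - d (g L) z) ^ 2 <= L ^ 2) by nra.
  assert (Htt : 0 <= tau * (1 - tau)) by nra.
  nra.
Qed.

(** [stewart] is applied along [g1] and then along [g2]; all terms cancel but
    [t^2 * d (g1 L1) (g2 L2)^2]. *)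
Lemma dist_fan {X : Type} (d : X -> X -> R) g1 g2 L1 L2 t :
  is_metric d -> is_CAT0 d -> geodesic_on d g1 L1 -> geodesic_on d g2 L2 ->
  g1 0 = g2 0 -> 0 <= t <= 1 ->
  d (g1 (t * L1)) (g2 (t * L2)) <= t * d (g1 L1) (g2 L2).
Proof.
  intros Hm Hc H1 H2 E Ht.
  assert (S1 := stewart d g1 L1 (g2 (t * L2)) t Hm Hc H1 Ht).
  assert (S2 := stewart d g2 L2 (g1 L1) t Hm Hc H2 Ht).
  assert (HL1 := proj1 H1). assert (HL2 := proj1 H2).
  assert (E1 : d (g1 0) (g2 (t * L2)) = t * L2).
  { rewrite E, (geodesic_on_dist d g2 L2); auto; nra. }
  assert (E2 : d (g2 0) (g1 L1) = L1).
  { rewrite <- E, (geodesic_on_dist d g1 L1); auto; lra. }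
  destruct Hm as [Hpos [_ [Hsym _]]].
  rewrite (Hsym (g2 (t * L2)) (g1 L1)), (Hsym (g2 L2) (g1 L1)), E2 in S2.
  rewrite E1 in S1.
  assert (P := Hpos (g1 L1) (g2 L2)).
  apply Rle_of_sq; [nra|]. eapply Rle_trans; [exact S1|].
  apply (Rmult_le_compat_l t) in S2; [|lra]. lra.
Qed.

(** The diagonal from [g1 0] to [g2 L2] cuts the figure into two fans, the second one read backwards
    from [g2 L2]. *)
Lemma dist_geodesics_convex {X : Type} (d : X -> X -> R) g1 g2 L1 L2 t :
  is_metric d -> is_CAT0 d -> geodesic_on d g1 L1 -> geodesic_on d g2 L2 ->
  0 <= t <= 1 ->
  d (g1 (t * L1)) (g2 (t * L2)) <=
    (1 - t) * d (g1 0) (g2 0) + t * d (g1 L1) (g2 L2).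
Proof.
  intros Hm Hc H1 H2 Ht.
  destruct (geodesic_on_exists d (g1 0) (g2 L2) Hm Hc) as [g3 [E0 [E3 H3]]].
  set (L3 := d (g1 0) (g2 L2)) in *.
  assert (F1 := dist_fan d g1 g3 L1 L3 t Hm Hc H1 H3 (eq_sym E0) Ht).
  assert (F2 := dist_fan d _ _ L3 L2 (1 - t) Hm Hc (geodesic_on_rev d g3 L3 H3)
                  (geodesic_on_rev d g2 L2 H2)).
  cbv beta in F2. rewrite !Rminus_0_r, !Rminus_diag, E0, E3 in F2.
  specialize (F2 eq_refl ltac:(lra)).
  replace (L3 - (1 - t) * L3) with (t * L3) in F2 by ring.
  replace (L2 - (1 - t) * L2) with (t * L2) in F2 by ring.
  rewrite E3 in F1. destruct Hm as [_ [_ [_ Htri]]].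
  assert (T := Htri (g1 (t * L1)) (g3 (t * L3)) (g2 (t * L2))). lra.
Qed.

(** [stewart] at the midpoint of one diagonal, seen from [x2] and from [x4], together with
    [(u + v)^2 <= 2 * u^2 + 2 * v^2]. *)
Lemma quadrilateral {X : Type} (d : X -> X -> R) (x1 x2 x3 x4 : X) :
  is_metric d -> is_CAT0 d ->
  d x1 x3 ^ 2 + d x2 x4 ^ 2 <=
    d x1 x2 ^ 2 + d x2 x3 ^ 2 + d x3 x4 ^ 2 + d x4 x1 ^ 2.
Proof.
  intros Hm Hc.
  destruct (geodesic_on_exists d x1 x3 Hm Hc) as [g [E0 [E1 Hg]]].
  assert (S2 := stewart d g _ x2 (1 / 2) Hm Hc Hg ltac:(lra)).
  assert (S4 := stewart d g _ x4 (1 / 2) Hm Hc Hg ltac:(lra)).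
  rewrite E0, E1 in S2, S4. set (m := g (1 / 2 * d x1 x3)) in *.
  destruct Hm as [Hpos [_ [Hsym Htri]]].
  assert (T := Htri x2 m x4). assert (P := Hpos x2 x4).
  rewrite (Hsym x2 m) in T. rewrite (Hsym x3 x2) in S2. rewrite (Hsym x1 x4) in S4.
  assert (Q : d x2 x4 ^ 2 <= 2 * d m x2 ^ 2 + 2 * d m x4 ^ 2).
  { assert (d x2 x4 ^ 2 <= (d m x2 + d m x4) ^ 2) by (apply pow_incr; lra).
    assert (S := pow2_ge_0 (d m x2 - d m x4)). lra. }
  lra.
Qed.

(** * Nearest points on the ray *)

(** The angle at [p] is at least a right angle: moving from [p] towards [q] by a fraction [tau]
    brings no point closer to [x], and [stewart] then leaves an error [tau * L^2] with [tau]
    arbitrarily small. *)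
Lemma obtuse_projection {X : Type} (d : X -> X -> R) o b x p q :
  is_metric d -> is_CAT0 d -> is_geodesic_ray d o b ->
  is_nearest d (ray_image b) x p -> ray_image b q ->
  d x p ^ 2 + d p q ^ 2 <= d x q ^ 2.
Proof.
  intros Hm Hc [_ Hb] [[s [Hs ->]] Hnear] [t [Ht ->]].
  assert (Hg : exists g, geodesic_on d g (d (b s) (b t)) /\ g 0 = b s /\
            g (d (b s) (b t)) = b t /\
            forall r, 0 <= r <= d (b s) (b t) -> ray_image b (g r)).
  { rewrite Hb by auto. destruct (Rle_dec s t) as [C|C].
    - rewrite Rabs_left1 by lra. exists (fun r => b (s + r)).
      split; [|split; [|split]].
      + split; [lra|]. intros u v Hu Hv. rewrite Hb by lra. f_equal; lra.
      + f_equal; lra.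
      + f_equal; lra.
      + intros r Hr. exists (s + r). split; [lra|reflexivity].
    - rewrite Rabs_right by lra. exists (fun r => b (s - r)).
      split; [|split; [|split]].
      + split; [lra|]. intros u v Hu Hv. rewrite Hb by lra.
        rewrite <- Rabs_Ropp. f_equal; lra.
      + f_equal; lra.
      + f_equal; lra.
      + intros r Hr. exists (s - r). split; [lra|reflexivity]. }
  destruct Hg as [g [Hg [E0 [E1 Hr]]]]. set (L := d (b s) (b t)) in *.
  assert (HL := proj1 Hg).
  assert (Hpos := proj1 Hm). assert (Hsym := proj1 (proj2 (proj2 Hm))).
  assert (Key : forall tau, 0 < tau <= 1 ->
            d x (b s) ^ 2 + L ^ 2 - d x (b t) ^ 2 <= tau * L ^ 2).
  { intros tau Htau.
    assert (S := stewart d g L x tau Hm Hc Hg ltac:(lra)).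
    assert (N := Hnear (g (tau * L)) (Hr _ (scaled_range tau L ltac:(lra) HL))).
    rewrite E0, E1, (Hsym (b s) x), (Hsym (b t) x), (Hsym (g _) x) in S.
    assert (P := Hpos x (b s)).
    assert (N2 : d x (b s) ^ 2 <= d x (g (tau * L)) ^ 2) by (apply pow_incr; lra).
    apply Rmult_le_reg_l with tau; [lra|]. lra. }
  destruct (Rle_dec (d x (b s) ^ 2 + L ^ 2) (d x (b t) ^ 2)) as [C|C]; [exact C|].
  exfalso. set (e := d x (b s) ^ 2 + L ^ 2 - d x (b t) ^ 2) in *.
  assert (He : 0 < e) by (unfold e; lra).
  (* [tau = 1] gives [e <= L^2], which makes [e / (2 * L^2)] admissible; that value forces
     [e <= e / 2]. *)
  assert (K1 := Key 1 ltac:(lra)).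
  assert (Ht2 : 0 < e / (2 * L ^ 2) <= 1).
  { split.
    - apply Rdiv_lt_0_compat; nra.
    - apply Rmult_le_reg_r with (2 * L ^ 2); [nra|].
      unfold Rdiv. rewrite Rmult_assoc, Rinv_l by nra. nra. }
  assert (K2 := Key _ Ht2).
  replace (e / (2 * L ^ 2) * L ^ 2) with (e / 2) in K2 by (field; nra).
  lra.
Qed.

(** [epsilon_spec] requires an infimum to exist; completeness supplies it as a supremum of negated
    distances. *)
Lemma dist_set_is_inf {X : Type} (d : X -> X -> R) x (Z : X -> Prop) :
  is_metric d -> (exists z, Z z) ->
  is_inf (fun s => exists z, Z z /\ s = d x z) (dist_set d x Z).
Proof.
  intros [Hpos _] [z0 Hz0]. unfold dist_set. apply epsilon_spec.
  destruct (completeness (fun s => exists z, Z z /\ s = - d x z)) as [m [Hub Hlub]].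
  - exists 0. intros s [z [_ ->]]. assert (P := Hpos x z). lra.
  - exists (- d x z0). exists z0. auto.
  - exists (- m). split.
    + intros s [z [Hz ->]].
      assert (A : - d x z <= m) by (apply Hub; exists z; auto). lra.
    + intros r Hr. assert (A : m <= - r).
      { apply Hlub. intros s [z [Hz ->]].
        assert (B : r <= d x z) by (apply Hr; exists z; auto). lra. }
      lra.
Qed.

Lemma dist_set_nearest {X : Type} (d : X -> X -> R) x (Z : X -> Prop) p :
  is_metric d -> is_nearest d Z x p -> dist_set d x Z = d x p.
Proof.
  intros Hm [Hp Hn].
  destruct (dist_set_is_inf d x Z Hm (ex_intro _ p Hp)) as [Hlb Hglb].
  apply Rle_antisym.
  - apply Hlb. exists p; auto.
  - apply Hglb. intros s [z [Hz ->]]. auto.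
Qed.

Lemma proj_set_nearest {X : Type} (d : X -> X -> R) x (Z : X -> Prop) p :
  is_metric d -> proj_set d Z x p -> is_nearest d Z x p.
Proof.
  intros Hm [Hp E]. split; [exact Hp|]. intros w Hw. rewrite E.
  destruct (dist_set_is_inf d x Z Hm (ex_intro _ p Hp)) as [Hlb _].
  apply Hlb. exists w; auto.
Qed.

(** * Corners as quasi-geodesics *)

(** By concavity between [0] and [3 * t]. It moves the bound from a corner to [x], since the corners
    used have norm at most three times that of [x]. *)
Lemma kappa_le_triple (kappa : R -> R) s t :
  is_sublinear_fn kappa -> 0 <= s <= 3 * t -> kappa s <= 3 * kappa t.
Proof.
  intros [H1 [Hmon [Hconc _]]] Hs.
  assert (A := Hmon s (3 * t) Hs).
  assert (B := Hconc (3 * t) 0 (1 / 3) ltac:(lra) ltac:(lra) ltac:(lra)).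
  replace (1 / 3 * (3 * t) + (1 - 1 / 3) * 0) with t in B by field.
  assert (C := H1 0 ltac:(lra)). lra.
Qed.

Lemma lipschitz_quasi_geodesic {X : Type} (d : X -> X -> R) beta s0 t0 :
  is_metric d -> s0 <= t0 ->
  (forall s t, s0 <= s -> s <= t -> t <= t0 ->
     (t - s) / 32 <= d (beta s) (beta t) <= t - s) ->
  is_quasi_geodesic_segment d 32 0 beta s0 t0.
Proof.
  intros [_ [_ [Hsym _]]] Hst H.
  assert (HA : forall s t, s0 <= s <= t0 -> s0 <= t <= t0 ->
            Rabs (s - t) / 32 <= d (beta s) (beta t) <= Rabs (s - t)).
  { intros s t Hs Ht. destruct (Rle_dec s t) as [C|C].
    - rewrite Rabs_left1 by lra. replace (- (s - t)) with (t - s) by ring.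
      apply H; lra.
    - rewrite Rabs_right by lra. rewrite Hsym. apply H; lra. }
  split; [exact Hst|]. split.
  - intros u Hu e He. exists e. split; [exact He|]. intros v Hv Huv.
    assert (A := HA u v Hu Hv). lra.
  - intros s t Hs Ht. assert (A := HA s t Hs Ht).
    assert (P := Rabs_pos (s - t)). lra.
Qed.

(* The slope [64/75 = 4/5 * 16/15] is what convexity leaves at height [H/16] of the
   average slope 4/5 up to height [H]. *)
Lemma corner_quasi_geodesic {X : Type} (d : X -> X -> R) g1 g2 h L :
  is_metric d -> geodesic_on d g1 h -> geodesic_on d g2 L -> g1 h = g2 0 ->
  (forall delta, 0 <= delta <= h ->
     L - 64 / 75 * delta <= d (g1 (h - delta)) (g2 L)) ->
  is_quasi_geodesic_segment d 32 0
    (fun r => if Rle_dec r h then g1 r else g2 (r - h)) 0 (h + L).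
Proof.
  intros Hm H1 H2 E Hslope.
  assert (Hh := proj1 H1). assert (HL := proj1 H2).
  apply lipschitz_quasi_geodesic; [exact Hm|lra|].
  intros s t Hs Hst Ht.
  destruct (Rle_dec s h) as [Cs|Cs]; destruct (Rle_dec t h) as [Ct|Ct]; try lra.
  - rewrite (geodesic_on_dist d g1 h); auto; lra.
  - destruct Hm as [_ [_ [Hsym Htri]]].
    assert (A1 : d (g1 s) (g1 h) = h - s) by (apply (geodesic_on_dist d g1 h); auto; lra).
    assert (A2 : d (g2 0) (g2 (t - h)) = t - h)
      by (rewrite (geodesic_on_dist d g2 L); auto; lra).
    assert (A3 : d (g2 (t - h)) (g2 L) = h + L - t)
      by (rewrite (geodesic_on_dist d g2 L); auto; lra).
    (* With [u = h - s] and [v = t - h], the distance is at least [u - v] and at least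
       [v - 64/75 * u]. A convex combination of the two is [11/289 * (u + v)], which exceeds
       [(u + v) / 32]. *)
    assert (T1 := Htri (g1 s) (g1 h) (g2 (t - h))). rewrite E in T1 at 2.
    assert (T2 := Htri (g1 s) (g2 (t - h)) (g1 h)). rewrite E in T2 at 2.
    rewrite (Hsym (g2 (t - h)) (g2 0)) in T2.
    assert (T3 := Htri (g1 s) (g2 (t - h)) (g2 L)).
    assert (S := Hslope (h - s) ltac:(lra)).
    replace (h - (h - s)) with s in S by ring. lra.
  - rewrite (geodesic_on_dist d g2 L); auto; lra.
Qed.

(** As [g 0] stays nearest to [g (H / 16)], the corner is at distance exactly [H / 16] from the ray,
    so the hypothesis on quasi-geodesics bounds this height. *)
Lemma corner_height {X : Type} (d : X -> X -> R) o kappa b M g H q :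
  is_metric d -> is_CAT0 d -> is_geodesic_ray d o b ->
  (forall (beta : R -> X) (s0 t0 : R),
     is_quasi_geodesic_segment d 32 0 beta s0 t0 ->
     ray_image b (beta s0) -> ray_image b (beta t0) ->
     forall u, s0 <= u <= t0 -> kappa_nbhd d o kappa (ray_image b) M (beta u)) ->
  geodesic_on d g H -> is_nearest d (ray_image b) (g H) (g 0) -> ray_image b q ->
  d (g H) q <= d (g 0) q + 4 / 5 * H ->
  H / 16 <= M * kap d o kappa (g (H / 16)).
Proof.
  intros Hm Hc Hb HM Hg [Hp Hn] Hq Hslope.
  assert (HH := proj1 Hg). set (h := H / 16).
  assert (Hh : 0 <= h <= H) by (unfold h; lra).
  assert (Hpos := proj1 Hm). assert (Hsym := proj1 (proj2 (proj2 Hm))).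
  assert (Htri := proj2 (proj2 (proj2 Hm))).
  assert (Eh : d (g h) (g 0) = h).
  { rewrite Hsym, (geodesic_on_dist d g H); auto; lra. }
  assert (EH : d (g H) (g 0) = H).
  { rewrite Hsym, (geodesic_on_dist d g H); auto; lra. }
  assert (EHh : d (g H) (g h) = H - h).
  { rewrite Hsym, (geodesic_on_dist d g H); auto; lra. }
  assert (Hnh : is_nearest d (ray_image b) (g h) (g 0)).
  { split; [exact Hp|]. intros w Hw. assert (A := Hn w Hw).
    assert (T := Htri (g H) (g h) w). lra. }
  assert (Hgh : geodesic_on d g h).
  { split; [lra|]. intros; apply Hg; lra. }
  destruct (geodesic_on_exists d (g h) q Hm Hc) as [g2 [E0 [E2 Hg2]]].
  set (L := d (g h) q) in *. assert (HL := proj1 Hg2).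
  assert (Hcorner : is_quasi_geodesic_segment d 32 0
            (fun r => if Rle_dec r h then g r else g2 (r - h)) 0 (h + L)).
  { apply corner_quasi_geodesic; auto. intros delta Hd. rewrite E2.
    destruct (Req_dec H 0) as [Z|Z].
    { replace delta with 0 by (unfold h in Hd; lra).
      rewrite Rminus_0_r. unfold L. lra. }
    assert (Hsub := geodesic_on_sub d g H (h - delta) H Hg ltac:(lra) ltac:(lra) ltac:(lra)).
    set (N := H - (h - delta)) in *. assert (HN : 0 < N) by (unfold N, h in *; lra).
    assert (Htau : 0 <= delta / N <= 1).
    { split.
      - apply Rmult_le_pos; [lra|]. left; apply Rinv_0_lt_compat; lra.
      - apply Rmult_le_reg_r with N; [lra|].
        unfold Rdiv. rewrite Rmult_assoc, Rinv_l by lra. unfold N; lra. }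
    (* Convexity between the heights [h - delta] and [H], evaluated at [h]. *)
    assert (C := dist_geodesic_convex d _ N q _ Hm Hc Hsub Htau).
    cbv beta in C.
    replace (h - delta + delta / N * N) with h in C by (field; lra).
    replace (h - delta + N) with H in C by (unfold N; ring).
    rewrite Rplus_0_r in C. fold L in C.
    assert (Hob := obtuse_projection d o b (g h) (g 0) q Hm Hc Hb Hnh Hq).
    fold L in Hob. assert (P0 := Hpos (g 0) q).
    assert (HLD : d (g 0) q <= L) by (apply Rle_of_sq; nra).
    apply (Rmult_le_compat_r N) in C; [|lra].
    replace (((1 - delta / N) * d (g (h - delta)) q + delta / N * d (g H) q) * N)
      with ((N - delta) * d (g (h - delta)) q + delta * d (g H) q) in C by (field; lra).
    assert (EN : N = 15 * h + delta) by (unfold N, h; lra).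
    rewrite EN in C.
    (* [64/5 * h] is [4/5 * H]; division by [15 * h] then leaves the slope [64/75]. *)
    assert (B : delta * d (g H) q <= delta * (L + 64 / 5 * h)).
    { apply Rmult_le_compat_l; [lra|]. unfold h; lra. }
    assert (h0 : 0 < h) by (unfold h; lra).
    apply Rmult_le_reg_l with (15 * h); [lra|]. lra. }
  assert (Hin := HM _ 0 (h + L) Hcorner).
  cbv beta in Hin. destruct (Rle_dec 0 h) as [_|]; [|lra].
  (* At the final parameter the first branch is taken exactly when [L = 0], and then [g h = q]. *)
  assert (Hend : (if Rle_dec (h + L) h then g (h + L) else g2 (h + L - h)) = q).
  { destruct (Rle_dec (h + L) h) as [C|C].
    - assert (L0 : L = 0) by lra. rewrite L0, Rplus_0_r.
      apply (proj1 (proj2 Hm)). exact L0.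
    - rewrite <- E2. f_equal. ring. }
  rewrite Hend in Hin. specialize (Hin Hp Hq h ltac:(lra)).
  destruct (Rle_dec h h) as [_|]; [|lra].
  unfold kappa_nbhd in Hin.
  rewrite (dist_set_nearest d (g h) _ (g 0) Hm Hnh), Eh in Hin. exact Hin.
Qed.

(** * Comparing the projections of two points *)

(** The obtuse angles at [p] and [q] bound the diagonals of [x y q p] from below, and
    [quadrilateral] bounds them from above. *)
Lemma projection_nonexpansive {X : Type} (d : X -> X -> R) o b x y p q :
  is_metric d -> is_CAT0 d -> is_geodesic_ray d o b ->
  is_nearest d (ray_image b) x p -> is_nearest d (ray_image b) y q ->
  d p q <= d x y.
Proof.
  intros Hm Hc Hb Hp Hq.
  assert (O1 := obtuse_projection d o b x p q Hm Hc Hb Hp (proj1 Hq)).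
  assert (O2 := obtuse_projection d o b y q p Hm Hc Hb Hq (proj1 Hp)).
  assert (Q := quadrilateral d x y q p Hm Hc).
  destruct Hm as [Hpos [_ [Hsym _]]].
  rewrite (Hsym q p) in *. rewrite (Hsym p x) in *.
  apply Rle_of_sq; [apply Hpos|]. lra.
Qed.

Lemma ray_image_base {X : Type} (d : X -> X -> R) o b :
  is_geodesic_ray d o b -> ray_image b o.
Proof. intros [E _]. exists 0. split; [lra|auto]. Qed.

(* Replacing [x] by a point at height at most [d p y] costs a little of the
   hypothesis [d x y <= d x p] but makes the height comparable to [d p q + d y q]. *)
Lemma lowered_point {X : Type} (d : X -> X -> R) g R0 y q :
  is_metric d -> is_CAT0 d -> geodesic_on d g R0 ->
  d (g R0) y <= R0 -> d y q <= d (g 0) y ->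
  d (g (Rmin R0 (d (g 0) y))) y <=
    d (g 0) q + 71 / 100 * (Rmin R0 (d (g 0) y) + d y q).
Proof.
  intros Hm Hc Hg Hxy Hk.
  assert (Hpos := proj1 Hm). assert (Hsym := proj1 (proj2 (proj2 Hm))).
  assert (T := proj2 (proj2 (proj2 Hm)) (g 0) q y). rewrite (Hsym q y) in T.
  assert (PD := Hpos (g 0) q). assert (Pk := Hpos y q).
  set (a := d (g 0) y) in *. assert (Pa : 0 <= a) by apply Hpos.
  unfold Rmin. destruct (Rle_dec R0 a) as [C|C]; [lra|].
  assert (Htau : 0 <= a / R0 <= 1).
  { split.
    - apply Rmult_le_pos; [lra|]. left; apply Rinv_0_lt_compat; lra.
    - apply Rmult_le_reg_r with R0; [lra|].
      unfold Rdiv. rewrite Rmult_assoc, Rinv_l by lra. lra. }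
  assert (S := stewart d g R0 y _ Hm Hc Hg Htau).
  assert (Ea : a / R0 * R0 = a) by (field; lra).
  rewrite Ea in S. fold a in S.
  assert (Sq : d (g R0) y ^ 2 <= R0 ^ 2) by (apply pow_incr; split; [apply Hpos|lra]).
  assert (B : d (g a) y ^ 2 <= 2 * a ^ 2).
  { eapply Rle_trans; [exact S|].
    apply (Rmult_le_compat_l (a / R0)) in Sq; [|lra].
    set (r := a / R0) in *.
    replace (r * (1 - r) * R0 ^ 2) with (r * R0 ^ 2 - (r * R0) ^ 2) by ring.
    rewrite Ea. assert (0 <= r * a ^ 2) by nra. lra. }
  (* [142/100] is just above [sqrt 2]. Half of it is the rate [71/100], because
     [a <= d (g 0) q + d y q] may replace one half of [142/100 * a]. *)
  assert (B2 : d (g a) y <= 142 / 100 * a) by (apply Rle_of_sq; nra).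
  lra.
Qed.

Lemma projections_close {X : Type} (d : X -> X -> R) o kappa b M x y p q :
  is_metric d -> is_CAT0 d -> is_sublinear_fn kappa -> is_geodesic_ray d o b ->
  (forall (beta : R -> X) (s0 t0 : R),
     is_quasi_geodesic_segment d 32 0 beta s0 t0 ->
     ray_image b (beta s0) -> ray_image b (beta t0) ->
     forall u, s0 <= u <= t0 -> kappa_nbhd d o kappa (ray_image b) M (beta u)) ->
  0 <= M ->
  is_nearest d (ray_image b) x p -> is_nearest d (ray_image b) y q ->
  d x y <= d x p ->
  d p q <= 82000 * M * kap d o kappa x.
Proof.
  intros Hm Hc Hk Hb HM M0 Hp Hq Hxy.
  assert (HDxy := projection_nonexpansive d o b x y p q Hm Hc Hb Hp Hq).
  assert (Oo := obtuse_projection d o b x p o Hm Hc Hb Hp (ray_image_base d o b Hb)).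
  assert (Oy := obtuse_projection d o b y q p Hm Hc Hb Hq (proj1 Hp)).
  assert (Hpos := proj1 Hm). assert (Hsym := proj1 (proj2 (proj2 Hm))).
  assert (Htri := proj2 (proj2 (proj2 Hm))).
  rewrite (Hsym q p) in Oy. rewrite (Hsym y p) in Oy.
  rewrite (Hsym p o), (Hsym x o) in Oo.
  assert (Kx : 1 <= kap d o kappa x) by (apply Hk, Hpos).
  assert (MK : 0 <= M * kap d o kappa x) by (apply Rmult_le_pos; lra).
  destruct (geodesic_on_exists d p x Hm Hc) as [g1 [E10 [E11 Hg1]]].
  destruct (geodesic_on_exists d q y Hm Hc) as [g2 [E20 [E21 Hg2]]].
  rewrite (Hsym p x) in *. rewrite (Hsym q y) in *.
  assert (Hlow := lowered_point d g1 (d x p) y q Hm Hc Hg1).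
  rewrite E10, E11 in Hlow.
  set (D := d p q) in *. set (R0 := d x p) in *. set (k := d y q) in *.
  set (a := d p y) in *.
  assert (PD : 0 <= D) by apply Hpos. assert (PR : 0 <= R0) by apply Hpos.
  assert (Pk : 0 <= k) by apply Hpos. assert (Pa : 0 <= a) by apply Hpos.
  assert (Po := Hpos o x). assert (Pop := Hpos o p).
  assert (HDa : D <= a) by (apply Rle_of_sq; nra).
  assert (Hka : k <= a) by (apply Rle_of_sq; nra).
  assert (HRo : R0 <= d o x) by (apply Rle_of_sq; nra).
  assert (Hpo : d o p <= d o x) by (apply Rle_of_sq; nra).
  assert (HaDk : a <= D + k).
  { assert (T := Htri p q y). rewrite (Hsym q y) in T. exact T. }
  assert (Ha2R : a <= 2 * R0).
  { assert (T := Htri p x y). rewrite (Hsym p x) in T. unfold a, R0 in *. lra. }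
  specialize (Hlow Hxy Hka).
  set (R1 := Rmin R0 a) in *.
  assert (HR1 : D <= R1 /\ R1 <= R0 /\ R1 <= a /\ k <= 2 * R1).
  { unfold R1, Rmin. destruct (Rle_dec R0 a); lra. }
  destruct HR1 as [HR1D [HR1R [HR1a HkR1]]].
  destruct (Req_dec D 0) as [ZD|ZD]; [lra|].
  (* Scaling both geodesics by [t] gives heights [H = D / 16] over [p] and [K = t * k] over [q],
     where the average rate [71/100] persists by convexity. *)
  set (t := D / (16 * R1)).
  assert (EH : t * R1 = D / 16) by (unfold t; field; lra).
  assert (Ht : 0 <= t <= 1).
  { split; apply Rmult_le_reg_r with R1; lra. }
  assert (Hg1' : geodesic_on d g1 R1) by (split; [lra|intros; apply Hg1; lra]).
  assert (F := dist_geodesics_convex d g1 g2 R1 k t Hm Hc Hg1' Hg2 Ht).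
  rewrite E10, E20, E21 in F. fold D in F.
  apply (Rmult_le_compat_l t) in Hlow; [|lra].
  rewrite EH in F.
  set (H := D / 16) in *. set (K := t * k) in *.
  assert (EHD : H = D / 16) by reflexivity. assert (EK : K = t * k) by reflexivity.
  clearbody H K t.
  assert (HF : d (g1 H) (g2 K) <= D + 71 / 100 * (H + K)) by lra.
  assert (HH : 0 < H) by lra.
  assert (HK : 0 <= K <= 2 * H).
  { rewrite EK. split; [nra|]. rewrite <- EH. nra. }
  assert (HHR : H <= R1) by lra.
  assert (HKk : K <= k) by (rewrite EK; nra).
  assert (G1 : geodesic_on d g1 H) by (split; [lra|intros; apply Hg1; lra]).
  assert (G2 : geodesic_on d g2 K) by (split; [lra|intros; apply Hg2; lra]).
  assert (N1 : is_nearest d (ray_image b) (g1 H) (g1 0)).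
  { rewrite E10. split; [apply Hp|]. intros w Hw.
    assert (A := proj2 Hp w Hw). assert (T := Htri x (g1 H) w).
    rewrite <- E10 at 1. rewrite (Hsym (g1 H) (g1 0)).
    rewrite (geodesic_on_dist d g1 R0) by (auto; lra).
    rewrite <- E11 in T at 2.
    rewrite (Hsym (g1 R0)), (geodesic_on_dist d g1 R0) in T by (auto; lra).
    fold R0 in A. lra. }
  assert (N2 : is_nearest d (ray_image b) (g2 K) (g2 0)).
  { rewrite E20. split; [apply Hq|]. intros w Hw.
    assert (A := proj2 Hq w Hw). assert (T := Htri y (g2 K) w).
    rewrite <- E20 at 1. rewrite (Hsym (g2 K) (g2 0)).
    rewrite (geodesic_on_dist d g2 k) by (auto; lra).
    rewrite <- E21 in T at 2.
    rewrite (Hsym (g2 k)), (geodesic_on_dist d g2 k) in T by (auto; lra).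
    fold k in A. lra. }
  assert (E1H : d (g1 0) (g1 H) = H) by (rewrite (geodesic_on_dist d g1 H); auto; lra).
  assert (E2K : d (g2 0) (g2 K) = K) by (rewrite (geodesic_on_dist d g2 K); auto; lra).
  rewrite E10 in E1H. rewrite E20 in E2K.
  (* A corner over [p] yields [D = 256 * (H / 16)], hence at most [768 * M] times kappa at [x]. *)
  assert (X1 : d (g1 H) q <= D + 4 / 5 * H -> D <= 82000 * M * kap d o kappa x).
  { intros C.
    assert (A := corner_height d o kappa b M g1 H q Hm Hc Hb HM G1 N1 (proj1 Hq)).
    rewrite E10 in A. specialize (A C).
    assert (B : kap d o kappa (g1 (H / 16)) <= 3 * kap d o kappa x).
    { apply kappa_le_triple; [exact Hk|]. split; [apply Hpos|].
      assert (T := Htri o p (g1 (H / 16))).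
      rewrite <- E10 in T at 2.
      rewrite (geodesic_on_dist d g1 H) in T by (auto; lra).
      lra. }
    apply (Rmult_le_compat_l M) in B; [|lra]. lra. }
  (* If [y] is this low, passing from [g2 K] to [q] costs at most [H / 20], and
     [71/100 + 171/2000 < 4/5] gives a corner over [p]. *)
  destruct (Rle_dec k (D / 20)) as [Ck|Ck].
  { apply X1. assert (HK20 : K <= H / 20).
    { rewrite EK, <- EH. nra. }
    assert (T := Htri (g1 H) (g2 K) q). rewrite (Hsym (g2 K) q) in T. lra. }
  (* From [R1 <= a <= D + k <= 21 * k]. A corner over [q] then bounds [D = 16 * H] by
     [16 * 21 * 48 * M] times kappa at [x], where [16 * 21 * 48 = 16128]. *)
  assert (HK21 : H <= 21 * K).
  { rewrite EK, <- EH. nra. }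
  destruct (Rle_dec (d (g1 H) q) (D + 4 / 5 * H)) as [C1|C1]; [auto|].
  destruct (Rle_dec (d (g2 K) p) (D + 4 / 5 * K)) as [C2|C2].
  { assert (A := corner_height d o kappa b M g2 K p Hm Hc Hb HM G2 N2 (proj1 Hp)).
    rewrite E20, (Hsym q p) in A. specialize (A C2).
    assert (B : kap d o kappa (g2 (K / 16)) <= 3 * kap d o kappa x).
    { apply kappa_le_triple; [exact Hk|]. split; [apply Hpos|].
      assert (T := Htri o q (g2 (K / 16))). assert (T' := Htri o p q).
      rewrite <- E20 in T at 2.
      rewrite (geodesic_on_dist d g2 K) in T by (auto; lra).
      fold D in T'. lra. }
    apply (Rmult_le_compat_l M) in B; [|lra]. lra. }
  exfalso.
  (* Without corners the squared diagonals contribute [8/5 * D * (H + K)] beyond [2 * D^2], the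
     squared sides only [142/100 * D * (H + K)] plus quadratic terms in [H] and [K]. For
     [D = 16 * H] and [K <= 2 * H] these terms do not fill the gap. *)
  assert (Q := quadrilateral d p (g1 H) (g2 K) q Hm Hc).
  rewrite E1H, (Hsym (g2 K) q), E2K, (Hsym q p), (Hsym p (g2 K)) in Q.
  fold D in Q.
  assert (PF := Hpos (g1 H) (g2 K)).
  assert (Q1 : (D + 4 / 5 * H) ^ 2 <= d (g1 H) q ^ 2) by (apply pow_incr; lra).
  assert (Q2 : (D + 4 / 5 * K) ^ 2 <= d (g2 K) p ^ 2) by (apply pow_incr; lra).
  assert (Q3 : d (g1 H) (g2 K) ^ 2 <= (D + 71 / 100 * (H + K)) ^ 2)
    by (apply pow_incr; lra).
  assert (ED : D = 16 * H) by lra. rewrite ED in Q, Q1, Q2, Q3.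
  assert (0 < H * H) by (apply Rmult_lt_0_compat; lra).
  assert (K * K <= 2 * H * K) by (apply Rmult_le_compat_r; lra).
  assert (0 <= H * K) by (apply Rmult_le_pos; lra). lra.
Qed.

(** * All pairs of nearest points *)

Theorem theorem3p9 (X : Type) (d : X -> X -> R) (o : X) (kappa : R -> R)
  (b : R -> X) (M : R) :
  is_metric d -> is_proper d -> is_CAT0 d ->
  is_sublinear_fn kappa ->
  is_geodesic_ray d o b ->
  (forall (beta : R -> X) (s0 t0 : R),
     is_quasi_geodesic_segment d 32 0 beta s0 t0 ->
     ray_image b (beta s0) -> ray_image b (beta t0) ->
     forall u, s0 <= u <= t0 -> kappa_nbhd d o kappa (ray_image b) M (beta u)) ->
  is_kappa_contracting d o kappa (ray_image b) (82000 * M).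
Proof.
  intros Hm _ Hc Hk Hb HM.
  assert (Hob := ray_image_base d o b Hb).
  assert (Hpos := proj1 Hm). assert (Hsym := proj1 (proj2 (proj2 Hm))).
  assert (Hrefl : forall z, d z z = 0) by (intros z; apply Hm; reflexivity).
  (* The constant curve at [o] on [[0, 0]] is an admissible quasi-geodesic, at distance 0 from the
     ray. *)
  assert (M0 : 0 <= M).
  { assert (A : kappa_nbhd d o kappa (ray_image b) M o).
    { refine (HM (fun _ => o) 0 0 _ Hob Hob 0 _); [|lra].
      apply lipschitz_quasi_geodesic; [exact Hm|lra|].
      intros s t Hs Hst Ht. rewrite Hrefl. lra. }
    unfold kappa_nbhd in A. rewrite (dist_set_nearest d o _ o Hm) in A.
    2:{ split; [exact Hob|]. intros w _. rewrite Hrefl. apply Hpos. }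
    rewrite Hrefl in A.
    assert (1 <= kap d o kappa o) by (apply Hk, Hpos). nra. }
  intros x y Hxy.
  assert (Huniq : forall z p q, is_nearest d (ray_image b) z p ->
            is_nearest d (ray_image b) z q -> d p q <= 82000 * M * kap d o kappa x).
  { intros z p q Hp Hq.
    assert (A := projection_nonexpansive d o b z z p q Hm Hc Hb Hp Hq).
    rewrite Hrefl in A.
    assert (1 <= kap d o kappa x) by (apply Hk, Hpos).
    assert (0 <= M * kap d o kappa x) by (apply Rmult_le_pos; lra). lra. }
  assert (Hmix : forall p q, proj_set d (ray_image b) x p ->
            is_nearest d (ray_image b) y q -> d p q <= 82000 * M * kap d o kappa x).
  { intros p q Hp Hq.
    apply (projections_close d o kappa b M x y); auto using proj_set_nearest.
    destruct Hp as [_ ->]. exact Hxy. }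
  intros p q [Hp|Hp] [Hq|Hq]; eauto using proj_set_nearest.
  (* Remaining case: [p] belongs to [y] and [q] to [x], the reverse of the order in [Hmix]. *)
  rewrite Hsym. eauto using proj_set_nearest.
Qed.
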